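(* Let $(X,\mathcal B)$ be a quasisymmetric $2$-$(v,k,\lambda)$ design with $1<k<v$ and intersection numbers $x,y$, where $k>x>y$, and let $r,b,K,R,S,d$ be the associated quantities defined in the context. Then the following three inequalities on the parameters of a quasisymmetric $2$-design are equivalent. Hobart's inequality: $$\frac{v-2}{v}\left(1+\frac{R^3}{K^2}-\frac{(R+1)^3}{(b-K-1)^2}\right)-\frac{(v-2k)^2\lambda}{k^2(k-1)(v-k)}\ \ge\ 0. \qquad (H)$$ Calderbank's inequality, where $\bar x=k-x$ and $\bar y=k-y$: $$(v-1)(v-2)\bar x\bar y-k(v-k)(v-2)(\bar x+\bar y)+k(v-k)\bigl(k(v-k)-1\bigr)\ \ge\ 0. \qquad (C)$$ Neumaier's inequality: $$B(B-A)\le AC, \qquad (N)$$ where $A=(v-1)(v-2)$, $B=r(k-1)(k-2)$ and $C=rd(x-1)(x-2)+r(r-1-d)(y-1)(y-2)$. That is, (H) is equivalent to (C), and (C) is equivalent to (N).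
   Context: A $2$-$(v,k,\lambda)$ design $(X,\mathcal B)$ is a finite set $X$ of $v$ points with a collection $\mathcal B$ of subsets of $X$ called blocks, all of size $k$, such that any two distinct points lie in precisely $\lambda$ blocks. It is quasisymmetric with intersection numbers $x,y$ if distinct blocks meet in either $x$ or $y$ points, where $x\ne y$ and both values occur. The number of blocks on each point is $r=\lambda(v-1)/(k-1)$, and the total number of blocks is $b=vr/k$. The intersection-$x$ graph of the design has vertex set $\mathcal B$, with two blocks adjacent when they meet in exactly $x$ points. It is strongly regular, that is, it is regular with both edges and nonedges, and the number of common neighbours of two distinct vertices depends only on whether they are adjacent. Its eigenvalues are $K>R>S$, where $$K=\frac{(r-1)k-(b-1)y}{x-y},\qquad R=\frac{r-\lambda-k+y}{x-y},\qquad S=-\frac{k-y}{x-y},$$ and $K$ is its valency. Finally, $$d=\frac{(\lambda-1)(k-1)-(r-1)(y-1)}{x-y},$$ which is the number of blocks on a point $u$ that are adjacent in this graph to a given block on $u$. *)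

(* Defs.v *)
From mathcomp Require Import all_boot all_order all_algebra.

Set Implicit Arguments.
Unset Strict Implicit.
Unset Printing Implicit Defensive.

Import Order.TTheory GRing.Theory Num.Theory.

(* [X] is the whole point set; [Bs] is a set, so blocks are not repeated. *)
Definition is_2design (X : finType) (Bs : {set {set X}}) (v k l : nat) : Prop :=
  [/\ #|X| = v,
      forall P : {set X}, P \in Bs -> #|P| = k
    & forall p q : X, p != q ->
        #|[set P in Bs | (p \in P) && (q \in P)]| = l].

Definition meets_in (X : finType) (Bs : {set {set X}}) (n : nat) : Prop :=
  exists P Q : {set X}, [/\ P \in Bs, Q \in Bs, P != Q & #|P :&: Q| = n].

Definition is_quasisymmetric (X : finType) (Bs : {set {set X}})
    (v k l x y : nat) : Prop :=
  [/\ is_2design Bs v k l,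
      x <> y,
      forall P Q : {set X}, P \in Bs -> Q \in Bs -> P != Q ->
        #|P :&: Q| = x \/ #|P :&: Q| = y,
      meets_in Bs x
    & meets_in Bs y].

Local Open Scope ring_scope.

(* The parameters are rationals from here on: the formulas below divide, and
   their differences may be negative (e.g. y - 1 when y = 0). For a
   quasisymmetric design, qs_r is the number of blocks on a point, qs_b the
   number of blocks, qs_K the valency of the intersection-x graph and qs_R its
   second largest eigenvalue; qs_d counts the blocks on a point u adjacent in
   this graph to a given block on u. *)

Definition qs_r (v k l : rat) : rat := l * (v - 1) / (k - 1).

Definition qs_b (v k l : rat) : rat := v * qs_r v k l / k.

Definition qs_K (v k l x y : rat) : rat :=
  ((qs_r v k l - 1) * k - (qs_b v k l - 1) * y) / (x - y).

Definition qs_R (v k l x y : rat) : rat :=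
  (qs_r v k l - l - k + y) / (x - y).

Definition qs_d (v k l x y : rat) : rat :=
  ((l - 1) * (k - 1) - (qs_r v k l - 1) * (y - 1)) / (x - y).

Definition Hobart_ineq (v k l x y : rat) : Prop :=
  let b := qs_b v k l in
  let K := qs_K v k l x y in
  let R := qs_R v k l x y in
  (v - 2) / v * (1 + R ^+ 3 / K ^+ 2 - (R + 1) ^+ 3 / (b - K - 1) ^+ 2)
    - (v - 2 * k) ^+ 2 * l / (k ^+ 2 * (k - 1) * (v - k)) >= 0.

Definition Calderbank_ineq (v k x y : rat) : Prop :=
  let x' := k - x in
  let y' := k - y in
  (v - 1) * (v - 2) * x' * y' - k * (v - k) * (v - 2) * (x' + y')
    + k * (v - k) * (k * (v - k) - 1) >= 0.

Definition Neumaier_ineq (v k l x y : rat) : Prop :=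
  let r := qs_r v k l in
  let d := qs_d v k l x y in
  let A := (v - 1) * (v - 2) in
  let B := r * (k - 1) * (k - 2) in
  let C := r * d * (x - 1) * (x - 2) + r * (r - 1 - d) * (y - 1) * (y - 2) in
  B * (B - A) <= A * C.

(* Main.v *)
(** Counting the blocks that meet a fixed block in x and in y points gives
    [lambda E = k (k - 1) X Y] with [X = k - x], [Y = k - y], [m = k (v - k)] and
    [E = m^2 - m (v - 1) (X + Y) + v (v - 1) X Y], so [E > 0] and lambda can be
    eliminated. The eigenvalues then satisfy [R / K = (m - v X) / m] and
    [(R + 1) / (b - K - 1) = (v Y - m) / m]; the denominators [K] and [b - K - 1]
    are positive because both intersection numbers occur. Writing [cal] for the
    left side of (C), the left side of (H) equals [v^2 X Y / (m^2 E)] times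
    [cal], and [A C - B (B - A)] equals [m ((v - 1) X Y / E)^2] times [cal]. *)

Require Import Defs.
From mathcomp Require Import all_boot all_order all_algebra.
From mathcomp Require Import ring.

Set Implicit Arguments.
Unset Strict Implicit.
Unset Printing Implicit Defensive.

Import Order.TTheory GRing.Theory Num.Theory.
Local Open Scope ring_scope.

(** * Identities between rational functions of the parameters, with lambda eliminated *)

Section Algebra.

Variables v k l x y : rat.

Let m := k * (v - k).
Let X := k - x.
Let Y := k - y.
Let E := m ^+ 2 - m * (v - 1) * (X + Y) + v * (v - 1) * X * Y.

Hypothesis k1 : 1 < k.
Hypothesis kv : k < v.
Hypothesis xk : x < k.
Hypothesis yx : y < x.
Hypothesis lgt0 : 0 < l.
Hypothesis lE : l * E = k * (k - 1) * X * Y.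

Let X_gt0 : 0 < X. Proof. by rewrite subr_gt0. Qed.
Let Y_gt0 : 0 < Y. Proof. by rewrite subr_gt0 (lt_trans yx). Qed.
Let k_gt0 : 0 < k. Proof. exact: lt_trans k1. Qed.
Let m_gt0 : 0 < m. Proof. by rewrite mulr_gt0 // subr_gt0. Qed.
Let E_gt0 : 0 < E.
Proof.
by rewrite -(pmulr_rgt0 _ lgt0) lE !mulr_gt0 // subr_gt0.
Qed.

Let k0 : k != 0. Proof. exact: lt0r_neq0. Qed.
Let k10 : k - 1 != 0. Proof. by rewrite subr_eq0 gt_eqF. Qed.
Let xy0 : x - y != 0. Proof. by rewrite subr_eq0 gt_eqF. Qed.
Let E0 : E != 0. Proof. exact: lt0r_neq0. Qed.

Let l_E : l = k * (k - 1) * X * Y / E.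
Proof. by rewrite -lE mulfK. Qed.

Let rE : qs_r v k l = k * (v - 1) * X * Y / E.
Proof. rewrite /qs_r l_E; field. by rewrite E0 k10. Qed.

Let bE : qs_b v k l = v * (v - 1) * X * Y / E.
Proof. rewrite /qs_b rE; field. by rewrite E0 k0. Qed.

Let vk0 : v - k != 0. Proof. by rewrite subr_eq0 gt_eqF. Qed.
Let v0 : v != 0. Proof. by rewrite gt_eqF // (lt_trans k_gt0). Qed.

Local Ltac clear_denominators :=
  have := E0; rewrite /E /X /Y /m; let Enz := fresh in
  intro Enz; field; by rewrite ?Enz ?k0 ?k10 ?xy0 ?vk0 ?v0.

Lemma qs_KE : qs_K v k l x y = m * Y * ((v - 1) * Y - m) / (E * (x - y)).
Proof. rewrite /qs_K rE bE; clear_denominators. Qed.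

(** The valency of the intersection-[y] graph: [b - K - 1] is [K] with [x] and [y] interchanged, and
    [E] is symmetric in [X] and [Y]. *)
Lemma qs_nonvalencyE : qs_b v k l - qs_K v k l x y - 1 =
  m * X * (m - (v - 1) * X) / (E * (x - y)).
Proof. rewrite qs_KE bE; clear_denominators. Qed.

Hypothesis K_gt0 : 0 < qs_K v k l x y.
Hypothesis K'_gt0 : 0 < qs_b v k l - qs_K v k l x y - 1.

Lemma qs_RE : qs_R v k l x y = qs_K v k l x y * ((m - v * X) / m).
Proof. rewrite /qs_R qs_KE rE l_E; clear_denominators. Qed.

(** [R + 1] is minus [R] with [x] and [y] interchanged, so this is the mirror image of [qs_RE]. *)
Lemma qs_R1E : qs_R v k l x y + 1 =
  (qs_b v k l - qs_K v k l x y - 1) * ((v * Y - m) / m).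
Proof. rewrite /qs_R qs_nonvalencyE rE l_E; clear_denominators. Qed.

Let cal := (v - 1) * (v - 2) * X * Y - k * (v - k) * (v - 2) * (X + Y)
    + k * (v - k) * (k * (v - k) - 1).

Lemma hobart_calderbankE :
  (v - 2) / v * (1 + qs_R v k l x y ^+ 3 / qs_K v k l x y ^+ 2
    - (qs_R v k l x y + 1) ^+ 3 / (qs_b v k l - qs_K v k l x y - 1) ^+ 2)
    - (v - 2 * k) ^+ 2 * l / (k ^+ 2 * (k - 1) * (v - k))
  = v ^+ 2 * X * Y / (m ^+ 2 * E) * cal.
Proof.
(* With [R] and [R + 1] written as multiples of [K] and [b - K - 1], the squared valencies cancel.
   This needs both valencies to be nonzero. *)
have cube (a b : rat) : a != 0 -> (a * b) ^+ 3 / a ^+ 2 = a * b ^+ 3.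
  by move=> a0; field.
rewrite qs_R1E qs_RE !cube ?lt0r_neq0 //.
rewrite qs_nonvalencyE qs_KE l_E /cal; clear_denominators.
Qed.

(** Because [(x - 1)(x - 2) - (y - 1)(y - 2) = (x - y)(x + y - 3)], the denominator [x - y] of [d]
    cancels in [C]. *)
Lemma neumaier_calderbankE :
  let r := qs_r v k l in
  let d := qs_d v k l x y in
  let A := (v - 1) * (v - 2) in
  let B := r * (k - 1) * (k - 2) in
  let C := r * d * (x - 1) * (x - 2) + r * (r - 1 - d) * (y - 1) * (y - 2) in
  A * C - B * (B - A) =
  k * (v - k) * ((v - 1) * X * Y / E) ^+ 2 * cal.
Proof. rewrite /= /qs_d rE l_E /cal; clear_denominators. Qed.

Lemma hobart_iff_calderbank : Hobart_ineq v k l x y <-> Calderbank_ineq v k x y.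
Proof.
rewrite /Hobart_ineq /Calderbank_ineq /= hobart_calderbankE pmulr_rge0 //.
have v_gt0 := lt_trans k_gt0 kv.
have num_gt0 := mulr_gt0 (mulr_gt0 (exprn_gt0 2 v_gt0) X_gt0) Y_gt0.
exact: divr_gt0 num_gt0 (mulr_gt0 (exprn_gt0 2 m_gt0) E_gt0).
Qed.

Lemma calderbank_iff_neumaier :
  Calderbank_ineq v k x y <-> Neumaier_ineq v k l x y.
Proof.
rewrite /Neumaier_ineq /Calderbank_ineq /=.
rewrite -[X in _ <-> is_true X]subr_ge0 neumaier_calderbankE.
have v1_gt0 : 0 < v - 1 by rewrite subr_gt0 (lt_trans k1).
have num_gt0 := mulr_gt0 (mulr_gt0 v1_gt0 X_gt0) Y_gt0.
by rewrite (pmulr_rge0 _ (mulr_gt0 m_gt0 (exprn_gt0 2 (divr_gt0 num_gt0 E_gt0)))).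
Qed.

End Algebra.

(** * Double counting in a 2-design, over the natural numbers *)

Section Counting.

Local Open Scope nat_scope.

Variables (X : finType) (Bs : {set {set X}}).

Lemma cardsI_sum (T : finType) (C P : {set T}) :
  #|C :&: P| = \sum_(p in C) (p \in P).
Proof.
rewrite -sum1_card big_mkcond [RHS]big_mkcond /=.
by apply: eq_bigr => p _; rewrite inE; do 2!case: (p \in _).
Qed.

(** Both sides count the triples [(p, q, P)] with [p] in [A] and [P], and [q] in [B] and [P]. *)
Lemma double_count_pairs (A B : {set X}) :
  \sum_(p in A) \sum_(q in B) #|[set P in Bs | (p \in P) && (q \in P)]| =
  \sum_(P in Bs) #|A :&: P| * #|B :&: P|.
Proof.
transitivity (\sum_(p in A) \sum_(q in B) \sum_(P in Bs) (p \in P) * (q \in P)).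
  apply: eq_bigr => p _; apply: eq_bigr => q _.
  rewrite -sum1_card big_mkcond [RHS]big_mkcond /=; apply: eq_bigr => P _.
  by rewrite inE; do 3!case: (_ \in _).
under eq_bigr => p _ do rewrite exchange_big.
rewrite exchange_big; apply: eq_bigr => P _ /=.
rewrite !cardsI_sum big_distrl /=; apply: eq_bigr => p _.
by rewrite big_distrr.
Qed.

Let deg p := #|[set P in Bs | p \in P]|.

Lemma sum_degree (A : {set X}) :
  \sum_(p in A) deg p = \sum_(P in Bs) #|A :&: P|.
Proof.
transitivity (\sum_(p in A) \sum_(P in Bs) (p \in P)).
  apply: eq_bigr => p _; rewrite /deg -sum1_card big_mkcond [RHS]big_mkcond /=.
  by apply: eq_bigr => P _; rewrite inE; do 2!case: (_ \in _).
by rewrite exchange_big; apply: eq_bigr => P _; rewrite cardsI_sum.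
Qed.

Variables (v k l : nat).
Hypothesis hD : is_2design Bs v k l.

Let sum_pair_row (A : {set X}) p : p \in A ->
  \sum_(q in A) #|[set P in Bs | (p \in P) && (q \in P)]| =
  deg p + (#|A| - 1) * l.
Proof.
(* The diagonal term [q = p] counts all blocks on [p]; every other term is [l]. *)
case: hD => _ _ hl pA; rewrite (big_setD1 p) //=; congr (_ + _).
  by apply: eq_card => P; rewrite !inE andbb.
rewrite (eq_bigr (fun=> l)) => [|q].
  by rewrite sum_nat_const (cardsD1 p A) pA addKn.
by rewrite !inE => /andP[qp _]; apply: hl; rewrite eq_sym.
Qed.

(** Pairs [(q, P)] with [p] and [q] in [P] are counted in two ways, [q = p] included. This is
    [r (k - 1) = l (v - 1)] in additive form. *)
Lemma degreeM p : deg p * k = deg p + (v - 1) * l.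
Proof.
case: (hD) => hv hk hl.
have := double_count_pairs [set p] setT.
rewrite big_set1 sum_pair_row ?inE // cardsT hv => ->.
rewrite -sum_nat_const big_mkcond [RHS]big_mkcond /=.
apply: eq_bigr => P _; rewrite inE setTI.
case: (boolP (P \in Bs)) => //= /hk ->.
case: (boolP (p \in P)) => pP.
  by rewrite (setIidPl _) ?sub1set // cards1 mul1n.
by rewrite (disjoint_setI0 _) ?cards0 // disjoints1.
Qed.

Lemma sum_sqr_intersections (P : {set X}) : P \in Bs ->
  \sum_(Q in Bs) #|P :&: Q| ^ 2 =
  \sum_(Q in Bs) #|P :&: Q| + k * ((k - 1) * l).
Proof.
case: (hD) => hv hk hl PB; rewrite -double_count_pairs -sum_degree.
rewrite -(hk _ PB) -sum_nat_const -big_split /=.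
by apply: eq_bigr => p pP; rewrite sum_pair_row.
Qed.

Lemma lambda_gt0 (P : {set X}) : P \in Bs -> 1 < k -> 0 < l.
Proof.
case: (hD) => hv hk hl PB k1.
have /card_gt1P[p [q [pP qP pq]]] : 1 < #|P| by rewrite hk.
by rewrite -(hl p q pq) card_gt0; apply/set0Pn; exists P; rewrite !inE PB pP.
Qed.

End Counting.

(** * The rational parameters as cardinalities, and the relation that determines lambda *)

Section DesignParameters.

Variables (X : finType) (Bs : {set {set X}}) (v k l : nat).
Hypothesis hD : is_2design Bs v k l.
Hypotheses (k1 : (1 < k)%N) (kv : (k < v)%N).

Local Notation r := (qs_r v%:R k%:R l%:R).
Local Notation b := (qs_b v%:R k%:R l%:R).

Let k10 : k%:R - 1 != 0 :> rat.
Proof. by rewrite subr_eq0 pnatr_eq1 gtn_eqF. Qed.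

Let k0 : k%:R != 0 :> rat.
Proof. by rewrite pnatr_eq0 gtn_eqF // ltnW. Qed.

Lemma degree_qs_r p : #|[set P in Bs | p \in P]|%:R = r.
Proof.
have := congr1 (fun n => n%:R : rat) (degreeM hD p).
rewrite natrM natrD natrM natrB ?(leq_trans _ kv) // => e.
apply: (mulIf k10); rewrite /qs_r divfK // mulrBr mulr1 e.
by rewrite addrAC subrr add0r mulrC.
Qed.

Lemma sum_intersections (A : {set X}) :
  \sum_(P in Bs) #|A :&: P|%:R = #|A|%:R * r.
Proof.
rewrite -natr_sum -sum_degree natr_sum (eq_bigr _ (fun p _ => degree_qs_r p)).
by rewrite sumr_const mulr_natl.
Qed.

Lemma card_qs_b : #|Bs|%:R = b.
Proof.
case: (hD) => hv hk _; apply: (mulIf k0).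
have := sum_intersections setT; rewrite cardsT hv /qs_b divfK // => <-.
rewrite -natrM -sum_nat_const natr_sum.
by apply: eq_bigr => P /hk; rewrite setTI => ->.
Qed.

Variables x y : nat.
Hypothesis xy : x <> y.
Hypothesis hBs : forall P Q : {set X}, P \in Bs -> Q \in Bs -> P != Q ->
  #|P :&: Q| = x \/ #|P :&: Q| = y.

Let num (P : {set X}) i := #|[set Q in Bs :\ P | #|P :&: Q| == i]|.

(** The three terms come from [Q = P] and from the blocks meeting [P] in [x] and in [y] points.
    Taking [f i] to be [1], [i] and [i ^ 2] yields the moment equations [count0], [count1] and
    [count2]. *)
Let sum_by_intersection (f : nat -> rat) P : P \in Bs ->
  \sum_(Q in Bs) f #|P :&: Q| =
  f k + (num P x)%:R * f x + (num P y)%:R * f y.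
Proof.
case: (hD) => _ hk _ PB; rewrite (big_setD1 P) //= setIid hk // -addrA.
congr (_ + _).
have numE i : (num P i)%:R * f i =
    \sum_(Q in Bs :\ P) (if #|P :&: Q| == i then f i else 0).
  rewrite mulr_natl -sumr_const [LHS]big_mkcond [RHS]big_mkcond /=.
  by apply: eq_bigr => Q _; rewrite inE; case: (Q \in _).
rewrite !numE -big_split /=; apply: eq_bigr => Q.
rewrite !inE eq_sym => /andP[QP QB].
have xyF : (x == y) = false by apply/eqP.
case: (hBs PB QB QP) => ->; rewrite eqxx ?xyF ?addr0 //.
by rewrite eq_sym xyF add0r.
Qed.

Section Block.

Variable P : {set X}.
Hypothesis PB : P \in Bs.

Let xy0 : x%:R - y%:R != 0 :> rat.
Proof. by rewrite subr_eq0 eqr_nat; apply/eqP. Qed.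

Let count0 : 1 + (num P x)%:R + (num P y)%:R = b.
Proof.
have := sum_by_intersection (fun=> 1) PB.
by rewrite sumr_const card_qs_b !mulr1.
Qed.

Let count1 :
  k%:R + (num P x)%:R * x%:R + (num P y)%:R * y%:R = k%:R * r.
Proof.
case: (hD) => _ hk _.
by rewrite -(sum_by_intersection (fun i => i%:R) PB) sum_intersections hk.
Qed.

Let count2 :
  k%:R ^+ 2 + (num P x)%:R * x%:R ^+ 2 + (num P y)%:R * y%:R ^+ 2 =
  k%:R * (r + (k%:R - 1) * l%:R).
Proof.
case: (hD) => _ hk _.
rewrite -(sum_by_intersection (fun i => i%:R ^+ 2) PB).
under eq_bigr do rewrite -natrX.
rewrite -natr_sum (sum_sqr_intersections hD PB) natrD natr_sum.
by rewrite sum_intersections hk // !natrM natrB 1?ltnW // mulrDr.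
Qed.

(** Eliminating [num P y] from [count0] and [count1] leaves a value independent of [P], so the
    intersection-[x] graph is regular. *)
Lemma qs_K_count : qs_K v%:R k%:R l%:R x%:R y%:R = (num P x)%:R.
Proof.
apply: (mulIf xy0); rewrite /qs_K divfK //; move: count0 count1.
move: (num P x)%:R (num P y)%:R => nx ny e0 e1.
rewrite mulrBl mul1r [r * _]mulrC -e1 -e0; ring.
Qed.

Lemma qs_nonvalency_count :
  b - qs_K v%:R k%:R l%:R x%:R y%:R - 1 = (num P y)%:R.
Proof. rewrite qs_K_count -count0; ring. Qed.

(* [k (k - 1)] times the equation [sum_(Q != P) (#|P :&: Q| - x) (#|P :&: Q| - y) = 0]. *)
Lemma quasisymmetric_lambda (K := k%:R : rat) (V := v%:R : rat) :
  let X := K - x%:R in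
  let Y := K - y%:R in
  let m := K * (V - K) in
  l%:R * (m ^+ 2 - m * (V - 1) * (X + Y) + V * (V - 1) * X * Y) =
  K * (K - 1) * X * Y.
Proof.
have e : K * (r + (K - 1) * l%:R) - (x%:R + y%:R) * (K * r) + x%:R * y%:R * b =
    (K - x%:R) * (K - y%:R).
  rewrite -count0 -count1 -count2; ring.
move=> /=; rewrite -[RHS]mulrA -e /qs_b /qs_r /K; field.
by rewrite k0 k10.
Qed.

Lemma num_gt0 i (Q : {set X}) :
  Q \in Bs -> P != Q -> #|P :&: Q| = i -> 0 < (num P i)%:R :> rat.
Proof.
move=> QB PQ e; rewrite ltr0n card_gt0; apply/set0Pn; exists Q.
by rewrite !inE QB eq_sym PQ e /=.
Qed.

End Block.
End DesignParameters.

Theorem mainTheorem1 (X : finType) (Bs : {set {set X}}) (v k l x y : nat)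
    (hD : is_quasisymmetric Bs v k l x y)
    (hk1 : (1 < k)%N) (hkv : (k < v)%N) (hxk : (x < k)%N) (hyx : (y < x)%N) :
  (Hobart_ineq v%:R k%:R l%:R x%:R y%:R <-> Calderbank_ineq v%:R k%:R x%:R y%:R)
  /\
  (Calderbank_ineq v%:R k%:R x%:R y%:R <->
     Neumaier_ineq v%:R k%:R l%:R x%:R y%:R).
Proof.
case: hD => hd xy hBs [P [Q [PB QB PQ eqx]]] [P' [Q' [PB' QB' PQ' eqy]]].
have k1 : 1 < k%:R :> rat by rewrite ltr1n.
have kv : k%:R < v%:R :> rat by rewrite ltr_nat.
have xk : x%:R < k%:R :> rat by rewrite ltr_nat.
have yx : y%:R < x%:R :> rat by rewrite ltr_nat.
have l_gt0 : 0 < l%:R :> rat by rewrite ltr0n (lambda_gt0 hd PB).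
have lE := quasisymmetric_lambda hd hk1 hkv xy hBs PB.
(* Both valencies can be computed from any base block, so the pair meeting in [x] points and the
   pair meeting in [y] points may be unrelated. *)
have K_gt0 : 0 < qs_K v%:R k%:R l%:R x%:R y%:R.
  rewrite (qs_K_count hd hk1 hkv xy hBs PB).
  exact: (num_gt0 QB PQ eqx).
have K'_gt0 : 0 < qs_b v%:R k%:R l%:R - qs_K v%:R k%:R l%:R x%:R y%:R - 1.
  rewrite (qs_nonvalency_count hd hk1 hkv xy hBs PB').
  exact: (num_gt0 QB' PQ' eqy).
split; first exact: hobart_iff_calderbank.
exact: calderbank_iff_neumaier.
Qed.
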